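(* Let $X$ and $Y$ be finite ordinal spaces. Then the Hasse diagrams $\mathcal H(\mathbf B_X)$ and $\mathcal H(\mathbf B_Y)$ of the posets $(\mathbf B_X,\subseteq)$ and $(\mathbf B_Y,\subseteq)$ are isomorphic as directed graphs if and only if there exists a bijective ball-preserving mapping $f\colon X\to Y$.
   Context: An ordinal space is an ordered triplet $(X,L,\delta)$, where $X$ is a set, $L$ is a linearly ordered set with minimal element $0$, and $\delta\colon X\times X\to L$ is a surjective mapping such that for all $x,y\in X$: (i) $\delta(x,y)=\delta(y,x)$; (ii) $\delta(x,y)=0$ if and only if $x=y$. It is finite if $X$ is finite. A cut $(A,B)$ of a linearly ordered set $S$ is a pair with $S=A\cup B$ such that each element of $A$ is less than each element of $B$. For $c\in X$ let $\operatorname{Sp}(c)=\{\delta(c,x)\mid x\in X\}\subseteq L$. A ball at the point $c$ is a set of the form $\{x\in X\mid\delta(c,x)\in A\}$, where $(A,B)$ is a cut of $\operatorname{Sp}(c)$ with $A\neq\varnothing$. $\mathbf B_X$ denotes the set of all balls (at all points) of $X$, partially ordered by inclusion. The Hasse diagram $\mathcal H(P)$ of a finite poset $(P,\leqslant)$ is the directed graph with vertex set $P$ and with an arc $\langle u,v\rangle$ if and only if $u\leqslant v$, $u\neq v$, and for every $w\in P$, $u\leqslant w\leqslant v$ implies $w=u$ or $w=v$. Directed graphs $(V,A_V)$ and $(W,A_W)$ are isomorphic if there is a bijection $F\colon V\to W$ with $\langle x,y\rangle\in A_V\Leftrightarrow\langle F(x),F(y)\rangle\in A_W$. A mapping $F\colon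 X\to Y$ between ordinal spaces is ball-preserving if for every $Z\in\mathbf B_X$ and every $W\in\mathbf B_Y$ one has $F(Z)\in\mathbf B_Y$ and $F^{-1}(W)\in\mathbf B_X$. *)

(* Defs.v *)
From HB Require Import structures.
From mathcomp Require Import all_boot all_order all_classical.

Set Implicit Arguments.
Unset Strict Implicit.
Unset Printing Implicit Defensive.

Import Order.TTheory.
Local Open Scope order_scope.
Local Open Scope classical_set_scope.

(* The minimal element 0 of L is its bottom [\bot]. *)
Record ordinalSpace := OrdinalSpace {
  point :> Type;
  disp : Order.disp_t;
  scale : bOrderType disp;
  delta : point -> point -> scale;
  delta_surj : forall l, exists x y, delta x y = l;
  delta_sym : forall x y, delta x y = delta y x;
  delta_eq0 : forall x y, delta x y = \bot <-> x = y
}.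

Definition finite_space (X : ordinalSpace) := finite_set [set: X].

Definition is_cut d (L : orderType d) (S A B : set L) :=
  S = A `|` B /\ forall a b, A a -> B b -> a < b.

Section Balls.
Variable X : ordinalSpace.

Definition Sp (c : X) : set (scale X) := range (delta c).

Definition is_ball_at (c : X) (Z : set X) :=
  exists A B : set (scale X),
    [/\ is_cut (Sp c) A B, A !=set0 & Z = [set x | A (delta c x)]].

Definition balls : set (set X) := [set Z | exists c, is_ball_at c Z].

(* Balls carry the order induced from [set X], which is inclusion. *)
Definition ball_poset : Type := balls.
HB.instance Definition _ := Choice.on ball_poset.
HB.instance Definition _ := SubType.copy ball_poset (set_type balls).
HB.instance Definition _ :=
  [SubChoice_isSubPOrder of ball_poset by <: with set_display].

Lemma ball_posetE (u v : ball_poset) : (u <= v) <-> \val u `<=` \val v.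
Proof. by rewrite -subsetEset. Qed.

End Balls.

Record digraph := Digraph {
  vertex :> Type;
  arc : vertex -> vertex -> Prop
}.

Definition digraph_iso (G H : digraph) :=
  exists F : G -> H, bijective F /\ forall x y, arc x y <-> arc (F x) (F y).

Definition hasse d (P : porderType d) : digraph :=
  @Digraph P (fun u v =>
    [/\ u <= v, u <> v & forall w : P, u <= w <= v -> w = u \/ w = v]).

Definition ball_preserving (X Y : ordinalSpace) (f : X -> Y) :=
  forall (Z : set X) (W : set Y), balls Z -> balls W ->
    balls (f @` Z) /\ balls (f @^-1` W).

(* Main.v *)
Require Import Defs.
From mathcomp Require Import all_boot all_order all_classical.

(** A bijective ball-preserving map acts on balls by direct images, with
    preimages as inverse, so it is an isomorphism of the posets of balls and
    hence of their Hasse diagrams ([hasse_iso]).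

    Conversely, a finite poset is recovered from its Hasse diagram: any
    strict inequality that is not a covering relation splits into two shorter
    ones, so a map that preserves arcs is monotone ([hasse_homo]).  An
    isomorphism of Hasse diagrams is therefore an order isomorphism [F] of the
    posets of balls.  Each singleton is a ball (take the cut whose lower part
    is the bottom distance) and each ball contains its center, so the
    singletons are exactly the minimal balls.  Thus [F] permutes singletons
    ([iso_ball1]) and induces a bijection [f] on points with
    [F [set x] = [set f x]].  Since [x] lies in [Z] exactly when [[set x]] is
    below [Z], this [f] satisfies [f @` Z = F Z] ([iso_mem]), and so preserves
    balls in both directions. *)

Set Implicit Arguments.
Unset Strict Implicit.
Unset Printing Implicit Defensive.

Import Order.TTheory.
Local Open Scope order_scope.
Local Open Scope classical_set_scope.

(** The rank function [mu] stands in for finiteness of [P]: it bounds the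
    number of times an inequality can be refined before only covers remain. *)
Lemma hasse_homo d d' (P : porderType d) (Q : porderType d') (mu : P -> nat)
    (F : P -> Q) :
  {homo mu : u v / u < v >-> (u < v)%N} ->
  (forall u v, @Defs.arc (hasse P) u v -> @Defs.arc (hasse Q) (F u) (F v)) ->
  {homo F : u v / u <= v}.
Proof.
move=> muP FP u v; have [n] := ubnP (mu v - mu u)%N.
elim: n u v => // n IH u v; rewrite ltnS => hn.
rewrite le_eqVlt => /predU1P[->//|uv].
have [[w [uw wv]]|nw] := pselect (exists w, u < w /\ w < v).
  have muw := muP _ _ uw; have mwv := muP _ _ wv.
  apply: (@le_trans _ _ (F w)).
    apply: IH (ltW uw); apply: leq_trans hn.
    by rewrite ltn_sub2r // (ltn_trans muw).
  apply: IH (ltW wv); apply: leq_trans hn.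
  by rewrite ltn_sub2l // (ltn_trans muw).
suff /FP[] : @Defs.arc (hasse P) u v by [].
split; [exact: ltW|by move=> e; rewrite e ltxx in uv|].
move=> w /andP[]; rewrite le_eqVlt => /predU1P[->|uw]; first by left.
rewrite le_eqVlt => /predU1P[->|wv]; first by right.
by case: nw; exists w.
Qed.

Lemma hasse_iso d d' (P : porderType d) (Q : porderType d') (F : P -> Q) :
  bijective F -> {mono F : u v / u <= v} -> digraph_iso (hasse P) (hasse Q).
Proof.
move=> [G FK GK] FP; exists F; split; first by exists G.
move=> u v /=; split=> -[uv nuv cov]; split.
- by rewrite FP.
- by move/(can_inj FK).
- move=> w; rewrite -(GK w) !FP => /cov[->|->]; [by left|by right].
- by rewrite -FP.
- by move=> e; apply: nuv; rewrite e.
- move=> w; rewrite -(FP u) -(FP w) => /cov[/(can_inj FK)|/(can_inj FK)] ->;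
  by [left|right].
Qed.

Section Balls.
Variable X : ordinalSpace.
Implicit Types (x : X) (u : ball_poset X).

Lemma balls1 x : balls [set x].
Proof.
exists x, [set \bot], (Sp x `\ \bot); split.
- split=> [|a b -> [_ /= /eqP]]; last by rewrite lt0x.
  rewrite setDUK // => _ ->.
  by exists x => //; apply/delta_eq0.
- by exists \bot.
- apply/seteqP; split=> y /=; first by move=> ->; apply/delta_eq0.
  by move=> /delta_eq0.
Qed.

Lemma balls_nonempty (Z : set X) : balls Z -> Z !=set0.
Proof.
move=> [c [A [B [[SAB AB] [a Aa] ->]]]]; exists c => /=.
have -> : delta c c = \bot by apply/delta_eq0.
have : (A `|` B) \bot by rewrite -SAB; exists c => //; apply/delta_eq0.
by case=> // /(AB a _ Aa); rewrite ltx0.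
Qed.

Definition ball_of (Z : set X) (hZ : balls Z) : ball_poset X :=
  Sub Z (mem_set hZ).

Lemma val_ball_of (Z : set X) (hZ : balls Z) : \val (ball_of hZ) = Z.
Proof. exact: SubK. Qed.

Lemma ballsP u : balls (\val u).
Proof. exact: set_mem (valP u). Qed.

Definition ball1 x := ball_of (balls1 x).

Lemma le_ball1 x u : ball1 x <= u <-> \val u x.
Proof. by rewrite ball_posetE val_ball_of sub1set inE. Qed.

(** Singletons are minimal because balls are nonempty. *)
Lemma le_ball1_eq x u : u <= ball1 x -> u = ball1 x.
Proof.
move=> ux; apply: le_anti; rewrite ux /=; apply/le_ball1.
have [y uy] := balls_nonempty (ballsP u).
by move/ball_posetE: ux => /(_ y uy); rewrite val_ball_of => <-.
Qed.

Lemma ball1_inj : injective ball1.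
Proof.
move=> x y e; have : ball1 x <= ball1 y by rewrite e.
by rewrite le_ball1 val_ball_of.
Qed.

(** Counting points along an enumeration of [X] makes inclusion strictly
    increasing. *)
Lemma finite_ball_rank : finite_space X ->
  exists mu : ball_poset X -> nat, {homo mu : u v / u < v >-> (u < v)%N}.
Proof.
move=> /(@finite_seqP {classic X})[s sE].
exists (fun u => count (fun x => `[< \val u x >]) s) => u v uv.
have [x vx nux] : exists2 x, \val v x & ~ \val u x.
  apply: contrapT => h; move: uv; rewrite lt_neqAle => /andP[/eqP nuv luv].
  apply: nuv; apply: le_anti; rewrite luv /=; apply/ball_posetE => x vx.
  by apply: contrapT => nux; apply: h; exists x.
have uv' : \val u `<=` \val v by apply/ball_posetE/ltW.
have xs : (x : {classic X}) \in s.
  by have : [set: {classic X}] x by []; rewrite sE.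
case/splitPr: xs => p1 p2; rewrite !count_cat /= (asboolT vx) (asboolF nux).
rewrite add0n add1n addnS ltnS leq_add // sub_count // => y /asboolP uy;
  by apply/asboolP/uv'.
Qed.

End Balls.

Section OrderIso.
Variables (X Y : ordinalSpace).
Variables (F : ball_poset X -> ball_poset Y) (G : ball_poset Y -> ball_poset X).
Hypotheses (FK : cancel F G) (GK : cancel G F).
Hypotheses (homoF : {homo F : u v / u <= v}) (homoG : {homo G : u v / u <= v}).

(** Any point [y] of [F (ball1 x)] works: [G (ball1 y)] is a ball below
    [ball1 x], hence equal to it. *)
Lemma iso_ball1 x : exists y, F (ball1 x) = ball1 y.
Proof.
have [y /le_ball1/homoG] := balls_nonempty (ballsP (F (ball1 x))).
by rewrite FK => /le_ball1_eq <-; exists y; rewrite GK.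
Qed.

Lemma iso_mem x y u : F (ball1 x) = ball1 y -> \val (F u) y <-> \val u x.
Proof.
move=> e; rewrite -!le_ball1 -e; split; last exact: homoF.
by move/homoG; rewrite !FK.
Qed.

End OrderIso.

Lemma image_can (T U : Type) (f : T -> U) (g : U -> T) (Z : set T) :
  cancel f g -> cancel g f -> f @` Z = g @^-1` Z.
Proof.
move=> fK gK; apply/seteqP; split=> y /=; first by case=> x Zx <-; rewrite fK.
by exists (g y).
Qed.

Lemma digraph_iso_ball_preserving (X Y : ordinalSpace) :
  finite_space X -> finite_space Y ->
  digraph_iso (hasse (ball_poset X)) (hasse (ball_poset Y)) ->
  exists f : X -> Y, bijective f /\ ball_preserving f.
Proof.
move=> /finite_ball_rank[muX muXP] /finite_ball_rank[muY muYP].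
move=> [F [[G FK GK] FP]].
have homoF : {homo F : u v / u <= v}.
  by apply: (hasse_homo muXP) => u v /FP.
have homoG : {homo G : u v / u <= v}.
  by apply: (hasse_homo muYP) => u v uv; apply/FP; rewrite !GK.
have [f fE] := choice (iso_ball1 FK GK homoG).
have [g gE] := choice (iso_ball1 GK FK homoF).
have fK : cancel f g by move=> x; apply: ball1_inj; rewrite -gE -fE FK.
have gK : cancel g f by move=> y; apply: ball1_inj; rewrite -fE -gE GK.
exists f; split; first by exists g.
move=> Z W hZ hW; split.
  suff -> : f @` Z = \val (F (ball_of hZ)) by exact: ballsP.
  rewrite (image_can _ fK gK) predeqE => y.
  by have := iso_mem FK homoF homoG (ball_of hZ) (fE (g y));
    rewrite gK val_ball_of; apply: iff_sym.
suff -> : f @^-1` W = \val (G (ball_of hW)) by exact: ballsP.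
rewrite predeqE => x.
by have := iso_mem GK homoG homoF (ball_of hW) (gE (f x));
  rewrite fK val_ball_of; apply: iff_sym.
Qed.

Lemma ball_preserving_digraph_iso (X Y : ordinalSpace) (f : X -> Y) :
  bijective f -> ball_preserving f ->
  digraph_iso (hasse (ball_poset X)) (hasse (ball_poset Y)).
Proof.
move=> [g fK gK] fP.
(* [ball_preserving] speaks of two balls at once, so each half is used with a
   singleton in place of the other ball. *)
have fB (u : ball_poset X) : balls (f @` \val u).
  have [x _] := balls_nonempty (ballsP u).
  by have [] := fP _ _ (ballsP u) (balls1 (f x)).
have gB (v : ball_poset Y) : balls (f @^-1` \val v).
  have [y _] := balls_nonempty (ballsP v).
  by have [] := fP _ _ (balls1 (g y)) (ballsP v).
apply: (@hasse_iso _ _ _ _ (fun u => ball_of (fB u))).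
  exists (fun v => ball_of (gB v)) => u; apply: val_inj; rewrite !val_ball_of.
    by rewrite (image_can _ fK gK) predeqE => x /=; rewrite fK.
  by rewrite (image_can _ fK gK) predeqE => y /=; rewrite gK.
move=> u v; apply/idP/idP => /ball_posetE uv; apply/ball_posetE.
  move=> x ux; have := uv (f x).
  by rewrite !val_ball_of !(image_can _ fK gK) /= fK; apply.
by rewrite !val_ball_of; exact: image_subset.
Qed.

Theorem theorem5p1 (X Y : ordinalSpace)
    (finX : finite_space X) (finY : finite_space Y) :
  digraph_iso (hasse (ball_poset X)) (hasse (ball_poset Y)) <->
  exists f : X -> Y, bijective f /\ ball_preserving f.
Proof.
split; first exact: digraph_iso_ball_preserving.
by move=> [f [fbij fP]]; exact: ball_preserving_digraph_iso fbij fP.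
Qed.
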